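(* Let the grid $a=t_0<t_1<\dots<t_n=b$ be equidistant with stepsize $h$, and let \[ C_{\mathrm{s}}=\begin{bmatrix} f & -e_1^T\\ & f & -e_1^T\\ & & \ddots & \ddots\\ & & & f & -e_1^T\end{bmatrix}\in\mathbb{R}^{(n-1)\times n(N+1)},\qquad f=\Big[1,\int_0^1p_0(\sigma)\,d\sigma,\dots,\int_0^1p_{N-1}(\sigma)\,d\sigma\Big]\in\mathbb{R}^{1\times(N+1)}, \] where $e_1\in\mathbb{R}^{N+1}$ is the first unit vector and $\{p_0,\dots,p_{N-1}\}$ is the chosen basis. Then: \begin{itemize} \item for the Legendre basis, $1\le\lambda_{\min}(C_{\mathrm{s}}C_{\mathrm{s}}^T)\le\lambda_{\max}(C_{\mathrm{s}}C_{\mathrm{s}}^T)\le5$; \item for the modified Legendre basis, $2N\le\lambda_{\min}(C_{\mathrm{s}}C_{\mathrm{s}}^T)\le\lambda_{\max}(C_{\mathrm{s}}C_{\mathrm{s}}^T)\le2N+6$; \item for the Chebyshev basis, $1\le\lambda_{\min}(C_{\mathrm{s}}C_{\mathrm{s}}^T)\le\lambda_{\max}(C_{\mathrm{s}}C_{\mathrm{s}}^T)\le4+2\ln2$; \item for the Runge–Kutta basis, if additionally $\int_0^1p_i(\sigma)\,d\sigma\ge0$ for $i=0,1,\dots,N-1$, then $N^{-1}\le\lambda_{\min}(C_{\mathrm{s}}C_{\mathrm{s}}^T)\le\lambda_{\max}(C_{\mathrm{s}}C_{\mathrm{s}}^T)\le5$. \end{itemize}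
   Context: $N\ge1$ and $n\ge2$ are integers. $\lambda_{\min},\lambda_{\max}$ denote smallest and largest eigenvalues of a symmetric matrix. In $C_{\mathrm{s}}$, the $j$-th row ($j=1,\dots,n-1$) has $f$ in the $j$-th block of $N+1$ columns, $-e_1^T$ in the $(j+1)$-th block, and zeros elsewhere. The bases $\{p_0,\dots,p_{N-1}\}$ of the polynomials of degree $\le N-1$ on $[0,1]$ are: Legendre basis: $p_i(\tau)=P_i(2\tau-1)$, with $P_i$ the Legendre polynomials (normalized by $P_i(1)=1$). Modified Legendre basis: $p_i=\bar p_{i+1}'$, where $\bar p_i(\tau)=P_i(2\tau-1)-(-1)^i$, $i=1,2,\dots$. Chebyshev basis: $p_i(\tau)=T_i(2\tau-1)$, with $T_i$ the Chebyshev polynomials of the first kind. Runge–Kutta basis: for nodes $0<\tau_1<\dots<\tau_N<1$, $p_i(\tau)=\prod_{\kappa\ne i+1}\frac{\tau-\tau_\kappa}{\tau_{i+1}-\tau_\kappa}$ (Lagrange polynomials), $i=0,\dots,N-1$. *)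

(* Defs.v *)
From HB Require Import structures.
From mathcomp Require Import all_boot all_order all_algebra.
From mathcomp Require Import all_classical all_reals all_analysis.

Set Implicit Arguments.
Unset Strict Implicit.
Unset Printing Implicit Defensive.
Import Order.TTheory GRing.Theory Num.Theory.

Local Open Scope ring_scope.

Section Defs.
Variable R : realType.

(* The default value 0 of xget is only reached when the real matrix A has no
   real eigenvalue, which never happens for a nonempty symmetric matrix. *)
Definition lambda_min (m : nat) (A : 'M[R]_m) : R :=
  xget 0 [set l : R | eigenvalue A l /\
                      forall l', eigenvalue A l' -> l <= l']%classic.

Definition lambda_max (m : nat) (A : 'M[R]_m) : R :=
  xget 0 [set l : R | eigenvalue A l /\
                      forall l', eigenvalue A l' -> l' <= l]%classic.

Definition int01 (p : {poly R}) : R :=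
  (\int[lebesgue_measure]_(s in `[0%R, 1%R]%classic) p.[s])%R.

(* Rodrigues' formula; the factor makes P_i(1) = 1. *)
Definition legendrep (i : nat) : {poly R} :=
  (2 ^+ i * i`!%:R)^-1 *: (('X^2 - 1) ^+ i)^`(i).

Fixpoint chebyshevp (i : nat) : {poly R} :=
  match i with
  | 0 => 1
  | S k => match k with
           | 0 => 'X
           | S l => 2%:P * 'X * chebyshevp k - chebyshevp l
           end
  end.

(* p(X) |-> p(2X - 1), from [-1, 1] to [0, 1] *)
Definition shift01 (p : {poly R}) : {poly R} := p \Po (2%:P * 'X - 1).

Definition legendre_basis (N : nat) (i : 'I_N) : {poly R} :=
  shift01 (legendrep i).

Definition legendre_bar (i : nat) : {poly R} :=
  shift01 (legendrep i) - ((-1) ^+ i)%:P.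

Definition modified_legendre_basis (N : nat) (i : 'I_N) : {poly R} :=
  (legendre_bar i.+1)^`().

Definition chebyshev_basis (N : nat) (i : 'I_N) : {poly R} :=
  shift01 (chebyshevp i).

(* The nodes are numbered from 0, so that p_i is attached to tau i. *)
Definition runge_kutta_basis (N : nat) (tau : 'I_N -> R) (i : 'I_N) :
    {poly R} :=
  \prod_(k < N | k != i) ((tau i - tau k)^-1 *: ('X - (tau k)%:P)).

Definition frow (N : nat) (p : 'I_N -> {poly R}) : 'rV[R]_N.+1 :=
  row_mx (const_mx 1 : 'rV_1) (\row_i int01 (p i)).

(* mxvec concatenates the rows of an n x (N+1) matrix; these rows are the n
   successive blocks of N+1 columns.  Here j and k are numbered from 0. *)
Definition Cs (n N : nat) (p : 'I_N -> {poly R}) : 'M[R]_(n.-1, n * N.+1) :=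
  \matrix_(j < n.-1)
    mxvec (\matrix_(k < n) (if k == j :> nat then frow p
                            else if k == j.+1 :> nat then - delta_mx 0 0
                            else 0)).

End Defs.

(* Main.v *)
(** Write w_i for the integral of p_i over [0, 1] and W for the sum of the
    w_i^2.  Since f starts with 1, C_s C_s^T is the tridiagonal Toeplitz matrix
    with W + 2 on the diagonal and -1 beside it, so by Gershgorin its
    eigenvalues lie in [W, W + 4].  The weights are w = (1, 0, 0, ...) for
    Legendre; w_i = 2 or 0 according to the parity of i for modified Legendre;
    w_i = 1/(1 - i^2) or 0 for Chebyshev, where W <= 1 + 1/6 by telescoping and
    ln 2 = ln (4/3) + ln (3/2) >= 7/12; and in the Runge-Kutta case nonnegative
    numbers of sum 1, so that 1/N <= W <= 1. *)

Require Import Defs.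
From mathcomp Require Import all_boot all_order all_algebra.
From mathcomp Require Import all_classical all_reals all_analysis.
From mathcomp Require Import polyrcf ring lra zify.

Set Implicit Arguments.
Unset Strict Implicit.
Unset Printing Implicit Defensive.
Import Order.TTheory GRing.Theory Num.Theory.
Import numFieldNormedType.Exports.

Local Open Scope ring_scope.

(** * Extreme eigenvalues and the tridiagonal Gram matrix *)

Section Spectrum.
Variable R : realType.

Lemma sum_ord_eq_nat (m k : nat) (F : nat -> R) :
  \sum_(i < m) F i * (i == k :> nat)%:R = if (k < m)%N then F k else 0.
Proof.
case: ltnP => [km|mk].
  rewrite (bigD1 (Ordinal km)) //= eqxx mulr1 big1 ?addr0 // => i.
  by rewrite -val_eqE /= => /negPf ->; rewrite mulr0.
by rewrite big1 // => i _; rewrite ltn_eqF ?mulr0 // (leq_trans (ltn_ord i)).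
Qed.

(** The condition on F 0 covers k = 0, which no shifted index i + 1 meets. *)
Lemma sum_ord_eqS_nat (m k : nat) (F : nat -> R) : (k <= m)%N -> F 0%N = 0 ->
  \sum_(i < m) F i.+1 * (i.+1 == k)%:R = F k.
Proof.
case: k => [_ ->|k km _]; first by rewrite big1 // => i _; rewrite mulr0.
under eq_bigr do rewrite eqSS.
by rewrite (sum_ord_eq_nat _ _ (fun i => F i.+1)) km.
Qed.

(** [eigenvalue] refers to row eigenvectors v, so the radii are column sums; v A = l v is read at an
    entry of v of largest modulus. *)
Lemma gershgorin (m : nat) (A : 'M[R]_m) (c r l : R) :
  (forall j, \sum_i `|A i j - c *+ (i == j)| <= r) ->
  eigenvalue A l -> `|l - c| <= r.
Proof.
move=> Ar /eigenvalueP[v vA /rV0Pn[i0 vi0]].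
have [i _ vmax] := @arg_maxP _ R _ i0 xpredT (fun i => `|v 0 i|) isT.
have vi : 0 < `|v 0 i| by rewrite (lt_le_trans _ (vmax i0 isT)) // normr_gt0.
rewrite -(ler_pM2r vi) -normrM.
have -> : (l - c) * v 0 i = \sum_k v 0 k * (A k i - c *+ (k == i)).
  have /matrixP/(_ 0 i) := vA; rewrite !mxE mulrBl => <-.
  under [RHS]eq_bigr do rewrite mulrBr.
  rewrite sumrB; congr (_ - _); rewrite (bigD1 i) //= eqxx mulr1n mulrC big1 ?addr0 //.
  by move=> k /negPf ->; rewrite mulr0n mulr0.
apply: le_trans (ler_norm_sum _ _ _) _.
apply: le_trans (ler_wpM2r (normr_ge0 _) (Ar i)).
rewrite mulr_suml; apply: ler_sum => k _.
by rewrite normrM mulrC ler_wpM2l //; exact: vmax.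
Qed.

(** A finite list of eigenvalues lets a smallest and a largest one be picked. *)
Lemma eigenvalue_finite (m : nat) (A : 'M[R]_m) :
  {s : seq R | forall l, eigenvalue A l = (l \in s)}.
Proof.
exists (rootsR (char_poly A)) => l; rewrite eigenvalue_root_char.
by rewrite -roots_on_rootsR ?in_itv ?monic_neq0 ?char_poly_monic.
Qed.

(** One known eigenvalue makes the list nonempty, so [xget] does not fall back on its default 0. *)
Lemma lambda_minP (m : nat) (A : 'M[R]_m) (l0 : R) : eigenvalue A l0 ->
  eigenvalue A (lambda_min A) /\
  forall l, eigenvalue A l -> lambda_min A <= l.
Proof.
have [s sE] := eigenvalue_finite A.
rewrite sE => /seq_tnthP[i0 _].
have [i _ imin] := @arg_minP _ R _ i0 xpredT (tnth (in_tuple s)) isT.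
apply: (@xgetPex _ 0 [set l | eigenvalue A l /\
  forall l', eigenvalue A l' -> l <= l']%classic).
exists (tnth (in_tuple s) i); split; first by rewrite sE mem_tnth.
by move=> l'; rewrite sE => /seq_tnthP[j ->]; exact: imin.
Qed.

Lemma lambda_maxP (m : nat) (A : 'M[R]_m) (l0 : R) : eigenvalue A l0 ->
  eigenvalue A (lambda_max A) /\
  forall l, eigenvalue A l -> l <= lambda_max A.
Proof.
have [s sE] := eigenvalue_finite A.
rewrite sE => /seq_tnthP[i0 _].
have [i _ imax] := @arg_maxP _ R _ i0 xpredT (tnth (in_tuple s)) isT.
apply: (@xgetPex _ 0 [set l | eigenvalue A l /\
  forall l', eigenvalue A l' -> l' <= l]%classic).
exists (tnth (in_tuple s) i); split; first by rewrite sE mem_tnth.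
by move=> l'; rewrite sE => /seq_tnthP[j ->]; exact: imax.
Qed.

Definition tridiag (m : nat) (c : R) : 'M[R]_m :=
  \matrix_(i, j) (c * (i == j :> nat)%:R - (i == j.+1 :> nat)%:R
                  - (i.+1 == j :> nat)%:R).

Lemma eigenvalue_tridiag_bound (m : nat) (c l : R) :
  eigenvalue (tridiag m c) l -> c - 2 <= l <= c + 2.
Proof.
have col_bound j : \sum_i `|tridiag m c i j - c *+ (i == j)| <= 2.
  (* Only rows j + 1 and j - 1 contribute. The factor [(0 < i.+1)%:R] is 1, written as F (i + 1)
     with F 0 = 0 to suit [sum_ord_eqS_nat]. *)
  apply: (@le_trans _ _ (\sum_(i < m) 1 * (i == j.+1 :> nat)%:R +
                         \sum_(i < m) (0 < i.+1)%:R * (i.+1 == j :> nat)%:R)).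
    rewrite -big_split; apply: ler_sum => i _ /=.
    rewrite mxE -val_eqE mulr_natr; set d := c *+ _.
    have -> : d - (i == j.+1 :> nat)%:R - (i.+1 == j :> nat)%:R - d =
      - ((i == j.+1 :> nat)%:R + (i.+1 == j :> nat)%:R) by ring.
    by rewrite normrN ger0_norm ?addr_ge0 ?ler0n // !mul1r.
  rewrite (sum_ord_eq_nat _ _ (fun=> 1)).
  rewrite (sum_ord_eqS_nat (F := fun i => (0 < i)%:R)) ?(ltnW (ltn_ord j)) //.
  by case: ifP => _; case: (0 < j)%N => /=; lra.
by move=> /(gershgorin col_bound); rewrite ler_distl.
Qed.

(* The vector (sin(k pi / (m+1)))_k vanishes at k = 0 and k = m + 1, so it is
   an eigenvector despite the truncated end rows. *)
Lemma eigenvalue_tridiag (m : nat) (c : R) : (0 < m)%N ->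
  eigenvalue (tridiag m c) (c - 2 * cos (pi / m.+1%:R)).
Proof.
move=> m_gt0; set x := pi / m.+1%:R.
pose s k := sin (k%:R * x).
have s0 : s 0%N = 0 by rewrite /s mul0r sin0.
have sm : s m.+1 = 0 by rewrite /s /x mulrC divfK ?pnatr_eq0 // sinpi.
have s1 : 0 < s 1%N.
  apply: sin_gt0_pi; rewrite mul1r /x divr_gt0 ?pi_gt0 ?ltr0n //=.
  by rewrite ltr_pdivrMr ?ltr0n // ltr_pMr ?pi_gt0 // ltr1n.
apply/eigenvalueP; exists (\row_i s i.+1); last first.
  by apply/rV0Pn; exists (Ordinal m_gt0); rewrite mxE gt_eqF.
apply/rowP => j; rewrite !mxE.
under eq_bigr do rewrite !mxE !mulrBr mulrCA.
rewrite !sumrB -mulr_sumr (sum_ord_eq_nat _ _ (fun i => s i.+1)).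
rewrite (sum_ord_eq_nat _ _ (fun i => s i.+1)) ltn_ord.
rewrite sum_ord_eqS_nat ?(ltnW (ltn_ord j)) //.
have -> : (if (j.+1 < m)%N then s j.+2 else 0) = s j.+2.
  by case: ltnP => // mj; rewrite -sm; congr s; have := ltn_ord j; lia.
(* The identity sin (y + x) + sin (y - x) = 2 sin y cos x at y = (j + 1) x produces the
   eigenvalue. *)
have sS : s j.+2 = sin (j.+1%:R * x + x) by rewrite /s; congr sin; ring.
have sP : s j = sin (j.+1%:R * x - x) by rewrite /s; congr sin; ring.
by rewrite sS sP /s sinD sinB; ring.
Qed.

(** The explicit eigenvalue only witnesses that the spectrum is nonempty and separates minimum from
    maximum; the outer bounds are Gershgorin's. *)
Lemma lambda_tridiag (m : nat) (c : R) : (0 < m)%N ->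
  [/\ c - 2 <= lambda_min (tridiag m c),
      lambda_min (tridiag m c) <= lambda_max (tridiag m c)
    & lambda_max (tridiag m c) <= c + 2].
Proof.
move=> /eigenvalue_tridiag => /(_ c) ev.
have [evm minl] := lambda_minP ev; have [evM maxl] := lambda_maxP ev.
split; last by case/andP: (eigenvalue_tridiag_bound evM).
  by case/andP: (eigenvalue_tridiag_bound evm).
exact: le_trans (minl _ ev) (maxl _ ev).
Qed.

(** Since f f^T = 1 + W and f e_1 = e_1^T e_1 = 1, each row has squared norm W + 2, neighbouring
    rows have product -1, and other pairs of rows share no block. *)
Lemma Cs_gram (n N : nat) (p : 'I_N -> {poly R}) :
  Cs n p *m (Cs n p)^T = tridiag n.-1 (\sum_i int01 (p i) ^+ 2 + 2).
Proof.
set W := \sum_i _.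
apply/matrixP => i j; rewrite !mxE.
(* Blocks i and i + 1 both exist for a row index i < n - 1, so no sum over blocks is truncated. *)
have ltSn (k : 'I_n.-1) : (k.+1 < n)%N by have := ltn_ord k; lia.
rewrite (reindex _ (curry_mxvec_bij n N.+1)) /=.
pose a (k : 'I_n) (u : nat) : R := (k == u :> nat)%:R.
have CsE (u : 'I_n.-1) (k : 'I_n) (l : 'I_N.+1) : Cs n p u (mxvec_index k l) =
    a k u * frow p 0 l - a k u.+1 * (l == 0)%:R.
  rewrite mxE mxvecE mxE /a; case: eqP => [->|_].
    by rewrite ltn_eqF // mul1r mul0r subr0.
  case: eqP => _; rewrite mul0r; last by rewrite mxE mul0r subr0.
  by rewrite !mxE eqxx mul1r add0r.
transitivity (\sum_(k < n) \sum_(l < N.+1)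
    (a k i * frow p 0 l - a k i.+1 * (l == 0)%:R) *
    (a k j * frow p 0 l - a k j.+1 * (l == 0)%:R)).
  rewrite pair_big /=; apply: eq_bigr => -[k l] _ /=.
  by rewrite (mxE trmx_key) !CsE.
(* In block k, the first column, where f has entry 1, gives the first two terms; the other N columns
   together give the term in W. *)
transitivity (\sum_(k < n) (((k == j :> nat)%:R - (k == j.+1 :> nat)%:R)
                              * (k == i :> nat)%:R
  - ((k == j :> nat)%:R - (k == j.+1 :> nat)%:R) * (k == i.+1 :> nat)%:R
  + W * (k == j :> nat)%:R * (k == i :> nat)%:R)).
  apply: eq_bigr => k _; rewrite big_ord_recl.
  have f0 : frow p 0 0 = 1.
    by rewrite mxE; case: splitP => // u _; rewrite mxE.
  have fS (l : 'I_N) : frow p 0 (lift ord0 l) = int01 (p l).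
    rewrite mxE; case: splitP => [u /=|u [/val_inj <-]]; last by rewrite mxE.
    by case: u => -[].
  rewrite f0 eqxx.
  have -> : \sum_(l < N) (a k i * frow p 0 (lift ord0 l)
                          - a k i.+1 * (lift ord0 l == 0)%:R) *
      (a k j * frow p 0 (lift ord0 l) - a k j.+1 * (lift ord0 l == 0)%:R)
      = a k i * a k j * W.
    rewrite mulr_sumr; apply: eq_bigr => l _.
    by rewrite fS (_ : (lift ord0 l == 0) = false) // mulr0n; ring.
  by rewrite /a mulr1n; ring.
rewrite big_split sumrB /=.
rewrite (sum_ord_eq_nat _ _ (fun k => (k == j :> nat)%:R - (k == j.+1 :> nat)%:R)).
rewrite (sum_ord_eq_nat _ _ (fun k => (k == j :> nat)%:R - (k == j.+1 :> nat)%:R)).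
rewrite (sum_ord_eq_nat _ _ (fun k => W * (k == j :> nat)%:R)).
by rewrite ltSn (ltnW (ltSn i)) eqSS; ring.
Qed.

Lemma lambda_Cs (n N : nat) (p : 'I_N -> {poly R}) (lo hi : R) :
  (2 <= n)%N -> lo <= \sum_i int01 (p i) ^+ 2 -> \sum_i int01 (p i) ^+ 2 + 4 <= hi ->
  let C := Cs n p in
  [/\ lo <= lambda_min (C *m C^T),
      lambda_min (C *m C^T) <= lambda_max (C *m C^T)
    & lambda_max (C *m C^T) <= hi].
Proof.
move=> n2 loW Whi /=; rewrite Cs_gram.
have n_gt0 : (0 < n.-1)%N by lia.
by have [] := lambda_tridiag (\sum_i int01 (p i) ^+ 2 + 2) n_gt0; split=> //; lra.
Qed.

End Spectrum.

(** * Integrals of polynomials over [0, 1] *)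

Section Integrals.
Variable R : realType.
Implicit Types p q : {poly R}.

Lemma int01_deriv q : int01 q^`() = q.[1] - q.[0].
Proof.
rewrite /int01 /Rintegral (@continuous_FTC2 _ _ (horner q)) //=.
- apply: continuous_subspaceT; exact: continuous_horner.
- split=> [x _||]; first exact: derivable_horner.
    by apply: cvg_at_right_filter; exact: continuous_horner.
  by apply: cvg_at_left_filter; exact: continuous_horner.
- by move=> x _; rewrite derivE.
Qed.

(** With antiderivatives at hand, additivity of [int01] follows from [int01_deriv] without a
    separate integrability argument. *)
Lemma poly_antideriv p : exists q, q^`() = p.
Proof.
(* At i = 0 the division by zero yields constant term 0. *)
exists (\poly_(i < (size p).+1) (p`_i.-1 / i%:R)).
apply/polyP => i; rewrite coef_deriv coef_poly ltnS.
case: ltnP => [_|/(nth_default 0) ->]; last by rewrite mul0rn.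
by rewrite -[LHS]mulr_natr divfK // pnatr_eq0.
Qed.

Lemma int01D p q : int01 (p + q) = int01 p + int01 q.
Proof.
have [[p' <-] [q' <-]] := (poly_antideriv p, poly_antideriv q).
by rewrite -derivD !int01_deriv !hornerD; ring.
Qed.

Lemma int01_sum (I : Type) (r : seq I) (P : pred I) (F : I -> {poly R}) :
  int01 (\sum_(i <- r | P i) F i) = \sum_(i <- r | P i) int01 (F i).
Proof.
apply: (big_morph _ int01D).
by rewrite -(deriv0 R) int01_deriv !horner0 subrr.
Qed.

Lemma int011 : int01 (1 : {poly R}) = 1.
Proof. by rewrite -(derivX R) int01_deriv !hornerX subr0. Qed.

Lemma horner_shift01_1 p : (shift01 p).[1] = p.[1].
Proof. by rewrite /shift01 horner_comp !hornerE /=; congr _.[_]; ring. Qed.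

Lemma horner_shift01_0 p : (shift01 p).[0] = p.[-1].
Proof. by rewrite /shift01 horner_comp !hornerE. Qed.

(** The substitution x = 2 tau - 1 has slope 2, whence the halving. *)
Lemma int01_shift01_deriv q : int01 (shift01 q^`()) = (q.[1] - q.[-1]) / 2.
Proof.
have -> : shift01 q^`() = (2^-1 *: shift01 q)^`().
  rewrite derivZ /shift01 deriv_comp.
  have -> : (2%:P * 'X - 1 : {poly R})^`() = 2%:P.
    by rewrite derivB -polyC1 derivC subr0 mul_polyC derivZ derivX alg_polyC.
  rewrite [RHS](_ : _ = (2^-1 * 2) *: (q^`() \Po (2%:P * 'X - 1))).
    by rewrite mulVf ?scale1r ?pnatr_eq0.
  by rewrite -scalerA -[2 *: _]mul_polyC [_ * 2%:P]mulrC.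
by rewrite int01_deriv !hornerZ horner_shift01_1 horner_shift01_0 mulrC mulrBl;
  congr (_ - _); exact: mulrC.
Qed.

(** * Legendre polynomials: endpoint values and integrals *)

Lemma derivn_factor (c : R) (r : {poly R}) (n k : nat) :
  exists2 s : {poly R}, (('X - c%:P) ^+ (n + k) * r)^`(k) = ('X - c%:P) ^+ n * s
    & s.[c] = ((n + k) ^_ k)%:R * r.[c].
Proof.
elim: k n => [|k IHk] n; first by exists r; rewrite ?addn0 ?derivn0 ?ffactn0 ?mul1r.
have [s Es sc] := IHk n.+1.
(* One derivative of (X - c)^(n+1) s leaves (X - c)^n times this witness, whose value at c is (n +
   1) s(c). *)
exists (n.+1%:R *: s + ('X - c%:P) * s^`()).
  rewrite addnS -addSn derivnS Es derivM deriv_exp derivXsubC mul1r /=.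
  by rewrite -mulr_natr scaler_nat -mulr_natr exprSr; ring.
rewrite hornerD hornerZ hornerM hornerXsubC subrr mul0r addr0 sc mulrA -natrM.
by congr (_%:R * _); rewrite addnS addSn ffactnSr mulnC; congr (_ * _)%N; lia.
Qed.

Lemma X2sub1_factor1 n : ('X^2 - 1 : {poly R}) ^+ n = ('X - 1%:P) ^+ n * ('X + 1%:P) ^+ n.
Proof. by rewrite -exprMn; congr (_ ^+ _); rewrite polyC1; ring. Qed.

Lemma X2sub1_factorN1 n :
  ('X^2 - 1 : {poly R}) ^+ n = ('X - (-1)%:P) ^+ n * ('X - 1%:P) ^+ n.
Proof. by rewrite -exprMn; congr (_ ^+ _); rewrite polyCN polyC1; ring. Qed.

(** All i derivatives in Rodrigues' formula fall on (X - 1)^i, giving i! (X + 1)^i at 1, and the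
    normalization cancels i! 2^i. *)
Lemma legendrep1 i : (legendrep R i).[1] = 1.
Proof.
have [s Es s1] := derivn_factor 1 (('X + 1%:P) ^+ i) 0 i.
move: Es s1; rewrite add0n expr0 mul1r -X2sub1_factor1 /legendrep hornerZ => -> ->.
rewrite ffactnn horner_exp hornerD hornerX hornerC -[1 + 1]/2 [_ * 2 ^+ i]mulrC.
by rewrite mulVf // mulf_neq0 ?expf_neq0 ?pnatr_eq0 // -lt0n fact_gt0.
Qed.

Lemma legendrepN1 i : (legendrep R i).[-1] = (-1) ^+ i.
Proof.
have [s Es s1] := derivn_factor (-1) (('X - 1%:P) ^+ i) 0 i.
move: Es s1; rewrite add0n expr0 mul1r -X2sub1_factorN1 /legendrep hornerZ => -> ->.
rewrite ffactnn horner_exp hornerD hornerX hornerN hornerC.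
have -> : (-1 - 1) ^+ i = 2 ^+ i * (-1) ^+ i :> R by rewrite -exprMn; congr (_ ^+ _); ring.
by rewrite [_%:R * (_ * _)]mulrCA [2 ^+ i * (_ * _)]mulrA mulKf.
Qed.

Lemma int01_legendre i : int01 (shift01 (legendrep R i)) = (i == 0%N)%:R.
Proof.
case: i => [|i].
  rewrite /legendrep expr0 derivn0 expr0 mul1r invr1 scale1r.
  by rewrite /shift01 -polyC1 comp_polyC polyC1 int011.
rewrite /legendrep derivnS -derivZ int01_shift01_deriv !hornerZ.
(* The antiderivative is differentiated only i times, so a simple factor X - c survives at each
   endpoint. *)
have root_end (c : R) r : ('X^2 - 1 : {poly R}) ^+ i.+1 = ('X - c%:P) ^+ i.+1 * r ->
    ((('X^2 - 1) ^+ i.+1)^`(i)).[c] = 0.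
  have [s + _ ->] := derivn_factor c r 1 i.
  by rewrite add1n => ->; rewrite expr1 hornerM hornerXsubC subrr mul0r.
by rewrite (root_end _ _ (X2sub1_factor1 _)) (root_end _ _ (X2sub1_factorN1 _)) !mulr0 subrr mul0r.
Qed.

Lemma int01_modified_legendre N (i : 'I_N) :
  int01 (@modified_legendre_basis R N i) = 2 * (~~ odd i)%:R.
Proof.
rewrite /modified_legendre_basis int01_deriv /legendre_bar !hornerD horner_shift01_1.
rewrite horner_shift01_0 legendrep1 legendrepN1.
by rewrite !hornerE -signr_odd /=; case: (odd i); rewrite /= ?expr0 ?expr1; ring.
Qed.

(** * Chebyshev polynomials and their integrals *)

Notation T := (@chebyshevp R).

Lemma chebyshevpSS n : T n.+2 = 2%:P * 'X * T n.+1 - T n.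
Proof. by []. Qed.

Lemma chebyshevp1 n : (T n).[1] = 1.
Proof.
suff [] : (T n).[1] = 1 /\ (T n.+1).[1] = 1 by [].
elim: n => [|n [IH1 IH2]]; first by rewrite !hornerE.
by split=> //; rewrite chebyshevpSS !hornerE IH1 IH2; ring.
Qed.

Lemma chebyshevpN1 n : (T n).[-1] = (-1) ^+ n.
Proof.
suff [] : (T n).[-1] = (-1) ^+ n /\ (T n.+1).[-1] = (-1) ^+ n.+1 by [].
elim: n => [|n [IH1 IH2]]; first by rewrite !hornerE.
by split=> //; rewrite chebyshevpSS !hornerE IH1 IH2 !exprS; ring.
Qed.

(** Chebyshev polynomials of the second kind, through which the derivatives of the T_n are
    expressed. *)
Fixpoint chebyshevu (n : nat) : {poly R} :=
  match n with
  | 0 => 1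
  | S k => match k with
           | 0 => 2%:P * 'X
           | S l => 2%:P * 'X * chebyshevu k - chebyshevu l
           end
  end.
Notation U := chebyshevu.

Lemma chebyshevuSS n : U n.+2 = 2%:P * 'X * U n.+1 - U n.
Proof. by []. Qed.

Lemma chebyshevp_u n : 2%:P * T n.+2 = U n.+2 - U n.
Proof.
suff [] : 2%:P * T n.+2 = U n.+2 - U n /\ 2%:P * T n.+3 = U n.+3 - U n.+1 by [].
elim: n => [|n [IH1 IH2]].
  by rewrite !chebyshevpSS !chebyshevuSS /= -[2%:P]/(2%:R%:P) polyC_natr; split; ring.
split=> //; rewrite chebyshevpSS (chebyshevuSS n.+2).
rewrite (_ : 2%:P * _ = 2%:P * 'X * (2%:P * T n.+3) - 2%:P * T n.+2); last by ring.
by rewrite IH1 IH2 (chebyshevuSS n); ring.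
Qed.

Lemma deriv_chebyshevp n : (T n.+1)^`() = n.+1%:R *: U n.
Proof.
rewrite scaler_nat -[RHS]mulr_natl.
suff [] : (T n.+1)^`() = n.+1%:R * U n /\ (T n.+2)^`() = n.+2%:R * U n.+1 by [].
elim: n => [|n [IH1 IH2]].
  rewrite chebyshevpSS /= !poly.derivE -[2%:P]/(2%:R%:P) polyC_natr.
  by split; ring.
split=> //; rewrite chebyshevpSS derivB derivM IH1 IH2 derivM derivC derivX.
(* Substituting 2 T_(n+2) = U_(n+2) - U_n and 2 X U_(n+1) = U_(n+2) + U_n cancels U_n and leaves (n
   + 3) U_(n+2). *)
rewrite (_ : _ + _ - _ = 2%:P * T n.+2 +
  (n.+2%:R * (2%:P * 'X * U n.+1) - n.+1%:R * U n)); last by ring.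
by rewrite chebyshevp_u (_ : 2%:P * 'X * U n.+1 = U n.+2 + U n);
  [ring | rewrite chebyshevuSS; ring].
Qed.

(** Combining [chebyshevp_u] and [deriv_chebyshevp] gives an antiderivative with T_(n+3) and
    T_(n+1), which have equal parity: for odd n the endpoint values cancel. *)
Lemma int01_chebyshev_ge2 n : int01 (shift01 (T n.+2)) =
  - (~~ odd n)%:R / (n.+1%:R * n.+3%:R).
Proof.
have nz1 : n.+1%:R != 0 :> R by rewrite pnatr_eq0.
have nz3 : n.+3%:R != 0 :> R by rewrite pnatr_eq0.
have -> : T n.+2 =
    ((2 * n.+3%:R)^-1 *: T n.+3 - (2 * n.+1%:R)^-1 *: T n.+1)^`().
  have half (x : R) : x != 0 -> (2 * x)^-1 * x = 2^-1 by move=> x0; field.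
  rewrite derivB !derivZ !deriv_chebyshevp !scalerA !half // -scalerBr.
  by rewrite -chebyshevp_u mul_polyC scalerA mulVf ?pnatr_eq0 // scale1r.
rewrite int01_shift01_deriv !hornerD !hornerN !hornerZ !chebyshevp1 !chebyshevpN1.
rewrite -(signr_odd _ n.+3) -(signr_odd _ n.+1) /= negbK.
by case: (odd n) => /=; rewrite ?expr1 ?expr0; field; rewrite !lt0r_neq0 ?ltr_pwDl.
Qed.

Lemma int01_chebyshev0 : int01 (shift01 (T 0)) = 1.
Proof. by rewrite /shift01 -polyC1 comp_polyC polyC1 int011. Qed.

Lemma int01_chebyshev1 : int01 (shift01 (T 1)) = 0.
Proof.
have -> : T 1 = (2^-1 *: 'X^2)^`().
  by rewrite derivZ derivXn -['X^_ *+ 2]scaler_nat scalerA mulVf ?pnatr_eq0 // scale1r expr1.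
by rewrite int01_shift01_deriv !hornerZ !hornerXn sqrrN subrr mul0r.
Qed.

Lemma sum_chebyshev_le N : \sum_(i < N) int01 (shift01 (T i)) ^+ 2 <= 7 / 6.
Proof.
pose w i := int01 (shift01 (T i)) ^+ 2.
(* The subtracted term makes the induction telescope, with equality at k = 0. Indices are added in
   pairs, the odd one contributing 0. *)
have S k : \sum_(0 <= i < k.*2.+2) w i <= 7 / 6 - (6 * k.*2.+1%:R)^-1.
  elim: k => [|k IHk].
    rewrite big_nat_recr // big_nat1 /= /w int01_chebyshev0 int01_chebyshev1 double0; lra.
  rewrite doubleS big_nat_recr // big_nat_recr //=.
  rewrite {2 3}/w !int01_chebyshev_ge2 /= odd_double /= oppr0 mul0r expr0n addr0.
  have : (0 : R) <= k.*2%:R by [].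
  move: IHk; rewrite -[k.*2.+3]addn3 -[k.*2.+1]addn1 !natrD.
  set S := \sum_(_ <= _ < _) _; set x := k.*2%:R => IHk x0.
  (* The right side is (x + 1)(x + 3)/3 times the left, and that factor is at least 1 since x >=
     0. *)
  have step : (-1 / ((x + 1) * (x + 3))) ^+ 2 <= (6 * (x + 1))^-1 - (6 * (x + 3))^-1.
    have -> : (6 * (x + 1))^-1 - (6 * (x + 3))^-1 =
      ((x + 1) * (x + 3) / 3) * (-1 / ((x + 1) * (x + 3))) ^+ 2.
      by field; apply/andP; split; apply/lt0r_neq0; lra.
    by apply: ler_peMl; [exact: sqr_ge0 | nra].
  lra.
have NN : (N <= N.*2.+2)%N by lia.
apply: le_trans (_ : \sum_(0 <= i < N.*2.+2) w i <= _).
  rewrite -(big_mkord xpredT w) (big_cat_nat (leq0n N) NN) /= lerDl.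
  by apply: sumr_ge0 => i _; exact: sqr_ge0.
apply: le_trans (S N) _; rewrite gerBl invr_ge0 mulr_ge0 //.
Qed.

(** The bound 7/6 + 4 <= 4 + 2 ln 2 needs exactly 7/12. The inequality 1 - 1/x <= ln x gives only
    1/2 at x = 2, but 1/4 + 1/3 at 4/3 and 3/2. *)
Lemma ln2_ge : 7 / 12 <= ln (2 : R).
Proof.
have lnge (x : R) : 0 < x -> 1 - x^-1 <= ln x.
  move=> x0; have := @le_ln1Dx R (x^-1 - 1); rewrite addrCA subrr addr0.
  by rewrite lnV ?posrE // ltrBrDl subrr invr_gt0 x0 => /(_ isT); lra.
have -> : 2 = (4 / 3) * (3 / 2) :> R by field.
rewrite lnM ?posrE; try lra.
have := lnge (4 / 3); have := lnge (3 / 2).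
by rewrite !invf_div => /(_ ltac:(lra)) h1 /(_ ltac:(lra)) h2; lra.
Qed.

(** * Runge-Kutta weights *)

Lemma sum_runge_kutta N (tau : 'I_N -> R) : (0 < N)%N -> injective tau ->
  \sum_i runge_kutta_basis tau i = 1.
Proof.
move=> N0 tau_inj; apply/eqP; rewrite -subr_eq0; apply/eqP.
have at_node i k : (runge_kutta_basis tau i).[tau k] = (i == k)%:R.
  rewrite horner_prod; case: eqVneq => [->|ik].
    apply: big1 => j jk; rewrite hornerZ hornerXsubC mulVf // subr_eq0.
    by rewrite (inj_eq tau_inj) eq_sym.
  by rewrite (bigD1 k) 1?eq_sym //= hornerZ hornerXsubC subrr mulr0 mul0r.
(* The sum minus 1 vanishes at N distinct nodes and has degree below N. *)
apply: (@roots_geq_poly_eq0 _ _ (codom tau)).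
- apply/allP => _ /codomP[k ->]; rewrite rootE hornerD horner_sum !hornerE.
  rewrite (bigD1 k) //= at_node eqxx big1 ?addr0 ?subrr // => i /negPf ik.
  by rewrite at_node ik.
- by rewrite map_inj_uniq ?enum_uniq.
rewrite size_codom card_ord.
apply: leq_trans (size_polyD _ _) _; rewrite size_polyN size_polyC oner_eq0 geq_max N0 andbT.
apply: leq_trans (size_sum _ _ _) _; apply/bigmax_leqP => i _.
rewrite /runge_kutta_basis scaler_prod.
apply: leq_trans (size_scale_leq _ _) _.
rewrite -big_filter size_prod_XsubC size_filter -sum1_count.
by rewrite (sum1_card (predC1 i)) cardC1 card_ord prednK.
Qed.

(** The lower bound expands the nonnegative sum of (w_i - 1/N)^2; the upper one uses w_i^2 <= w_i,
    as each w_i is at most the total 1. *)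
Lemma sum_sqr_weights N (w : 'I_N -> R) : (0 < N)%N ->
  (forall i, 0 <= w i) -> \sum_i w i = 1 -> N%:R^-1 <= \sum_i w i ^+ 2 <= 1.
Proof.
move=> N0 w0 w1.
have Npos : 0 < N%:R :> R by rewrite ltr0n.
apply/andP; split.
  have : 0 <= \sum_i (w i - N%:R^-1) ^+ 2 by apply: sumr_ge0 => i _; exact: sqr_ge0.
  have -> : \sum_i (w i - N%:R^-1) ^+ 2 =
      \sum_i w i ^+ 2 - N%:R^-1 * 2 * (\sum_i w i) + \sum_(i < N) N%:R^-1 ^+ 2.
    by rewrite mulr_sumr -sumrB -big_split; apply: eq_bigr => i _ /=; ring.
  rewrite w1 sumr_const card_ord -[_ ^+ 2 *+ N]mulr_natr [N%:R^-1 ^+ 2]expr2.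
  by rewrite divfK ?gt_eqF //; lra.
rewrite -w1; apply: ler_sum => i _.
have wi1 : w i <= 1.
  by rewrite -w1 (bigD1 i) //= lerDl sumr_ge0.
by rewrite expr2 ler_piMl.
Qed.

(** * Sums of squared weights for the two Legendre bases *)

Lemma sum_sqr_legendre N : (0 < N)%N ->
  \sum_(i < N) int01 (@legendre_basis R N i) ^+ 2 = 1.
Proof.
case: N => // N _; rewrite big_ord_recl /= big1 => [|i _]; rewrite int01_legendre.
  by rewrite addr0 expr1n.
by rewrite expr0n.
Qed.

(** Each even i < N contributes 4; the parity term records the extra even index when N is odd. *)
Lemma sum_sqr_modified_legendre N :
  \sum_(i < N) int01 (@modified_legendre_basis R N i) ^+ 2 = 2 * N%:R + 2 * (odd N)%:R.
Proof.
under eq_bigr do rewrite int01_modified_legendre.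
elim: N => [|N IHN]; first by rewrite big_ord0 !mulr0 addr0.
by rewrite big_ord_recr /= IHN -natr1; case: (odd N) => /=; ring.
Qed.

End Integrals.

Theorem proposition4 (R : realType) (N n : nat) (a b h : R) (t : nat -> R)
    (hN : (1 <= N)%N) (hn : (2 <= n)%N)
    (ht0 : t 0%N = a) (htn : t n = b)
    (ht_incr : forall j : nat, (j < n)%N -> t j < t j.+1)
    (ht_equidistant : forall j : nat, (j < n)%N -> t j.+1 - t j = h) :
  [/\ let C := Cs n (@legendre_basis R N) in
      [/\ 1 <= lambda_min (C *m C^T),
          lambda_min (C *m C^T) <= lambda_max (C *m C^T)
        & lambda_max (C *m C^T) <= 5],
      let C := Cs n (@modified_legendre_basis R N) in
      [/\ 2 * N%:R <= lambda_min (C *m C^T),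
          lambda_min (C *m C^T) <= lambda_max (C *m C^T)
        & lambda_max (C *m C^T) <= 2 * N%:R + 6],
      let C := Cs n (@chebyshev_basis R N) in
      [/\ 1 <= lambda_min (C *m C^T),
          lambda_min (C *m C^T) <= lambda_max (C *m C^T)
        & lambda_max (C *m C^T) <= 4 + 2 * ln 2]
    & forall tau : 'I_N -> R,
        (forall i : 'I_N, 0 < tau i < 1) ->
        (forall i k : 'I_N, (i < k)%N -> tau i < tau k) ->
        (forall i : 'I_N, 0 <= int01 (runge_kutta_basis tau i)) ->
        let C := Cs n (runge_kutta_basis tau) in
        [/\ N%:R^-1 <= lambda_min (C *m C^T),
            lambda_min (C *m C^T) <= lambda_max (C *m C^T)
          & lambda_max (C *m C^T) <= 5]].
Proof.
split.
- by apply: lambda_Cs; rewrite // sum_sqr_legendre //; lra.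
- apply: lambda_Cs; rewrite // sum_sqr_modified_legendre; first by rewrite lerDl.
  by case: (odd N) => /=; lra.
- apply: lambda_Cs => //.
    (* The weight of T_0 alone already gives the lower bound 1. *)
    rewrite -(prednK hN) big_ord_recl /chebyshev_basis int01_chebyshev0 expr1n lerDl.
    by apply: sumr_ge0 => i _; exact: sqr_ge0.
  have := sum_chebyshev_le R N; have := ln2_ge R.
  by rewrite /chebyshev_basis; lra.
move=> tau _ tau_lt w_ge0.
have tau_inj : injective tau.
  move=> i k tau_ik; apply: val_inj.
  by case: (ltngtP i k) => // /tau_lt; rewrite tau_ik ltxx.
(* The Lagrange polynomials sum to 1, and so do their integrals. *)
have sum_w : \sum_i int01 (runge_kutta_basis tau i) = 1.
  by rewrite -int01_sum sum_runge_kutta // int011.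
have /andP[lo hi] := sum_sqr_weights hN w_ge0 sum_w.
by apply: lambda_Cs => //; lra.
Qed.
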